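(* Let $\tau(n)$ be the number of unlabelled trees (isomorphism classes of trees) on $n$ vertices and $\sigma(n)$ the number of those that satisfy the neighbour sum property. Then the trees satisfying the neighbour sum property have positive density, i.e. $\liminf_{n\to\infty}\sigma(n)/\tau(n)>0$.
   Context: A graph $\mathcal G=(\mathcal V,\mathcal E)$ satisfies the neighbour sum property if there exists $f:\mathcal V\to\mathbb R$ with $f\not\equiv 0$ such that $f(x)=\sum_{y:\{x,y\}\in\mathcal E} f(y)$ for every $x\in\mathcal V$. *)

(* Defs.v *)
From HB Require Import structures.
From mathcomp Require Import all_boot all_order all_algebra all_fingroup.
From mathcomp Require Import all_classical all_reals all_analysis.

Set Implicit Arguments.
Unset Strict Implicit.
Unset Printing Implicit Defensive.

Import Order.TTheory GRing.Theory Num.Theory.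

Local Open Scope ring_scope.

(* A graph on the vertex set T is given by its edge set E : {set {set T}}. *)

Definition adj (T : finType) (E : {set {set T}}) : rel T :=
  fun x y => [set x; y]%SET \in E.

Definition simple_graph (T : finType) (E : {set {set T}}) : Prop :=
  forall e : {set T}, e \in E -> #|e| = 2%N.

Definition connected_graph (T : finType) (E : {set {set T}}) : Prop :=
  (0 < #|T|)%N /\ forall x y : T, connect (adj E) x y.

(* The bound on the length discards the degenerate closed walk x, y, x along
   a single edge, which ucycle accepts as the sequence [:: x; y]. *)
Definition acyclic_graph (T : finType) (E : {set {set T}}) : Prop :=
  forall c : seq T, (2 < size c)%N -> ~ ucycle (adj E) c.

Definition is_tree (T : finType) (E : {set {set T}}) : Prop :=
  [/\ simple_graph E, connected_graph E & acyclic_graph E].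

Definition neighbour_sum_property (R : realType) (T : finType)
    (E : {set {set T}}) : Prop :=
  exists f : T -> R, (exists x, f x <> 0) /\
    forall x, f x = \sum_(y | adj E x y) f y.

Definition graph_iso (T : finType) : rel {set {set T}} :=
  fun E E' => [exists s : {perm T},
    [forall x, forall y, adj E' (s x) (s y) == adj E x y]].

Lemma graph_iso_equiv (T : finType) : equivalence_rel (@graph_iso T).
Proof.
have refl (E : {set {set T}}) : graph_iso E E.
  by apply/existsP; exists 1%g; apply/forallP => x; apply/forallP => y; rewrite !perm1.
have sym (E E' : {set {set T}}) : graph_iso E E' -> graph_iso E' E.
  move=> /existsP[s /forallP sP]; apply/existsP; exists (s^-1)%g.
  apply/forallP => x; apply/forallP => y.
  by have /forallP/(_ ((s^-1)%g y)) := sP ((s^-1)%g x); rewrite !permKV eq_sym.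
have trans (E E' E'' : {set {set T}}) :
    graph_iso E E' -> graph_iso E' E'' -> graph_iso E E''.
  move=> /existsP[s /forallP sP] /existsP[t /forallP tP].
  apply/existsP; exists (s * t)%g; apply/forallP => x; apply/forallP => y.
  rewrite !permM.
  have /forallP/(_ (s y))/eqP-> := tP (s x).
  by have /forallP/(_ y) := sP x.
move=> E E' E''; split=> [|EE']; first exact: refl.
by apply/idP/idP; apply: trans => //; apply: sym.
Qed.

Definition iso_classes (n : nat) (P : {set {set 'I_n}} -> Prop) :
    {set {set {set {set 'I_n}}}} :=
  equivalence_partition (@graph_iso 'I_n) [set E | `[< P E >]]%SET.

Definition tau (n : nat) : nat :=
  #|iso_classes (fun E : {set {set 'I_n}} => is_tree E)|.

Definition sigma (R : realType) (n : nat) : nat :=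
  #|iso_classes (fun E : {set {set 'I_n}} =>
      is_tree E /\ neighbour_sum_property R E)|.

(* Main.v *)
(* A tree with a spider, i.e. a vertex carrying two pendant paths with two
   vertices each, has the neighbour sum property. Every tree with more than five
   vertices has a vertex [q] carrying a union [W] of branches with
   5 <= #|W| <= 8. If the tree has no spider, replace [W] by a single branch on
   the same vertices whose root [c] is a spider. Then [c] is the only spider of
   the new tree, so the new tree determines where the surgery took place, and
   together with the isomorphism type of the original tree on [W] and [q], of
   which there are boundedly many, it determines the original tree. Hence
   [tau n <= M * sigma n] with [M] independent of [n]. *)
Require Import Defs.
From mathcomp Require Import all_boot all_order all_algebra all_fingroup.
From mathcomp Require Import all_classical all_reals all_analysis.
From mathcomp Require Import lra zify finset.

Set Implicit Arguments.
Unset Strict Implicit.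
Unset Printing Implicit Defensive.

Import Order.TTheory GRing.Theory Num.Theory.

(** * Adjacency, connectivity and cycles *)

Lemma adj_sym (T : finType) (E : {set {set T}}) : symmetric (adj E).
Proof. by move=> x y; rewrite /adj setUC. Qed.

Lemma simple_adj_neq (T : finType) (E : {set {set T}}) x y :
  simple_graph E -> adj E x y -> x != y.
Proof. by move=> sE /sE; rewrite cards2; case: eqVneq. Qed.

Lemma set2_eq (T : finType) (x y a b : T) :
  [set x; y]%SET = [set a; b]%SET -> (x = a /\ y = b) \/ (x = b /\ y = a).
Proof.
move=> /setP eq_xy_ab.
have := eq_xy_ab x; have := eq_xy_ab y; have := eq_xy_ab a; have := eq_xy_ab b.
rewrite !inE !eqxx !orbT /=.
case/orP=> /eqP->; case/orP=> /eqP->; rewrite ?eqxx ?orbb //=; try tauto.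
  by move=> /esym/eqP->; left.
by move=> _ /esym/eqP->; left.
Qed.

(** [r] need not be symmetric, so each edge may be listed in one direction only. *)
Definition graph_of_rel (T : finType) (r : rel T) : {set {set T}} :=
  [set e : {set T} | [exists x, exists y, r x y && (e == [set x; y]%SET)]]%SET.

Lemma adj_graph_of_rel (T : finType) (r : rel T) x y :
  adj (graph_of_rel r) x y = r x y || r y x.
Proof.
rewrite /adj inE; apply/existsP/orP => [[a /existsP[b /andP[rab /eqP]]]|].
  by case/set2_eq=> -[-> ->]; [left | right].
case=> rxy; first by exists x; apply/existsP; exists y; rewrite rxy eqxx.
by exists y; apply/existsP; exists x; rewrite rxy setUC eqxx.
Qed.

Lemma simple_graph_of_rel (T : finType) (r : rel T) :
  irreflexive r -> simple_graph (graph_of_rel r).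
Proof.
move=> rxx e; rewrite inE => /existsP[x /existsP[y /andP[rxy /eqP->]]].
by rewrite cards2; case: eqVneq rxy => // ->; rewrite rxx.
Qed.

Lemma connected_closed_set (T : finType) (E : {set {set T}}) (A : {set T}) x0 :
  connected_graph E -> x0 \in A ->
  (forall x y, x \in A -> adj E x y -> y \in A) -> forall x, x \in A.
Proof.
move=> [_ cE] Ax0 clA x; have clAE : fingraph.closed (adj E) (mem A).
  apply: intro_closed => [|u v euv Au]; last exact: clA Au euv.
  by apply: sym_connect_sym; apply: adj_sym.
by rewrite -(closed_connect clAE (cE x0 x)).
Qed.

(** Once the cycle is rotated to start at [x], its second and its last vertex are the two
    neighbours; they differ because the cycle has more than two vertices. *)
Lemma ucycle_two_neighbours (T : finType) (e : rel T) (c : seq T) x :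
  symmetric e -> ucycle e c -> 2 < size c -> x \in c ->
  exists y z, [/\ y \in c, z \in c, y != z, e x y & e x z].
Proof.
move=> e_sym /andP[cyc_c uniq_c] size_c xc.
have [i p c_rot] := rot_to xc.
move: cyc_c uniq_c size_c; rewrite -(rot_cycle i) -(rot_uniq i) -(size_rot i).
have mem_c y : (y \in c) = (y \in x :: p) by rewrite -c_rot mem_rot.
rewrite c_rot; case: p mem_c {c_rot} => [|y p] // mem_c.
case: (lastP p) mem_c => [|p' z] // mem_c.
rewrite /= !rcons_path last_rcons => /and3P[exy _ ezx] /and3P[_ + _] _.
rewrite mem_rcons inE negb_or => /andP[yz _]; exists y, z.
split=> //; last by rewrite e_sym.
- by rewrite mem_c !inE eqxx orbT.
- by rewrite mem_c !inE mem_rcons inE eqxx !orbT.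
Qed.

(** * Spiders *)

(** A pendant path [v - a - b]. The condition [v != b] excludes an isolated edge, where [a] would be
    a leaf. *)
Definition pendant_edge (T : finType) (E : {set {set T}}) (v a b : T) : Prop :=
  [/\ v != b, forall y, adj E a y = (y == v) || (y == b)
    & forall y, adj E b y = (y == a)].

Definition spider (T : finType) (E : {set {set T}}) (v : T) : Prop :=
  exists a1 b1 a2 b2,
    [/\ a1 != a2, pendant_edge E v a1 b1 & pendant_edge E v a2 b2].

(* The eigenvector is 1 on one pendant edge, -1 on the other, 0 elsewhere. *)
Lemma spider_neighbour_sum (R : realType) (T : finType) (E : {set {set T}}) v :
  spider E v -> neighbour_sum_property R E.
Proof.
move=> [a1 [b1 [a2 [b2 [a12 [vb1 a1E b1E] [vb2 a2E b2E]]]]]].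
pose f y : R := ((y == a1)%:R + (y == b1)%:R - (y == a2)%:R - (y == b2)%:R)%R.
exists f; split.
  (* If [a1 = b2], then [a1] is a leaf at [a2], so its neighbours [v] and [b1] both equal [a2],
     against [v != b1]. Hence nothing cancels the value at [a1]. *)
  have a1b2 : a1 != b2.
    apply/eqP=> eq_a1b2; have := b2E v; rewrite -eq_a1b2 a1E eqxx /=.
    move=> /esym/eqP va2; have := b2E b1; rewrite -eq_a1b2 a1E eqxx orbT.
    by move=> /esym/eqP b1a2; rewrite va2 b1a2 eqxx in vb1.
  exists a1; rewrite /f eqxx (negPf a12) (negPf a1b2).
  by case: (a1 == b1) => /=; lra.
move=> x.
have sum1 a : (\sum_(y | adj E x y) (y == a)%:R = (adj E x a)%:R :> R)%R.
  have [xa|xa] := boolP (adj E x a).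
    by rewrite (bigD1 a) //= eqxx big1 ?addr0 // => y /andP[_ /negPf->].
  by rewrite big1 // => y; case: eqVneq => // ->; rewrite (negPf xa).
rewrite /f !big_split /= !sumrN !sum1 !(adj_sym E x) a1E b1E a2E b2E.
case: (eqVneq x v) => [->|_] /=; last by lra.
by rewrite (negPf vb1) (negPf vb2); lra.
Qed.

Lemma spider_iso (T : finType) (E E' : {set {set T}}) (g : {perm T}) v :
  (forall x y, adj E' (g x) (g y) = adj E x y) -> spider E v -> spider E' (g v).
Proof.
move=> gE [a1 [b1 [a2 [b2 [a12 p1 p2]]]]].
have pend_g a b : pendant_edge E v a b -> pendant_edge E' (g v) (g a) (g b).
  move=> [vb aE bE]; split; first by rewrite (inj_eq perm_inj).
    by move=> y; rewrite -[y](permKV g) gE aE !(inj_eq perm_inj).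
  by move=> y; rewrite -[y](permKV g) gE bE !(inj_eq perm_inj).
exists (g a1), (g b1), (g a2), (g b2).
by split; rewrite ?(inj_eq perm_inj) //; apply: pend_g.
Qed.

(** * Limbs *)

(** Equivalently, a union of connected components of the graph with [q] removed. *)
Definition limb (T : finType) (E : {set {set T}}) (q : T) (W : {set T}) : Prop :=
  q \notin W /\ forall x y, x \in W -> adj E x y -> (y == q) || (y \in W).

(* A branch of a limb at [q] and its complement in the limb are again limbs at
   [q]; a branch without its root [w] is a limb at [w]. Hence a limb with more
   than 8 vertices contains a smaller one with at least 5. *)
Lemma bounded_limb (T : finType) (E : {set {set T}}) :
  is_tree E -> 5 < #|T| -> exists q W, limb E q W /\ 5 <= #|W| <= 8.
Proof.
move=> [sE cE aE] card_T.
suff shrink k q (W : {set T}) : #|W| <= k -> 5 <= #|W| -> limb E q W ->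
    exists q' W', limb E q' W' /\ 5 <= #|W'| <= 8.
  have /card_gt0P[q _] : 0 < #|T| by apply: leq_ltn_trans card_T.
  apply: (shrink #|T| q [set~ q]%SET (max_card _)).
    by rewrite cardsC1; lia.
  by split=> [|x y _ _]; rewrite !inE ?eqxx // orbN.
elim: k q W => [|k IHk] q W leWk geW [qW clW]; first by lia.
have [W8|W8] := leqP #|W| 8; first by exists q, W; rewrite geW W8; split.
have [w wW qw] : exists2 w, w \in W & adj E q w.
  have [/existsP[w /andP[]]|] := boolP [exists w in W, adj E q w].
    by move=> wW qw; exists w.
  rewrite negb_exists => /forallP nqW; exfalso.
  have /card_gt0P[x0 x0W] : 0 < #|W| by lia.
  have := connected_closed_set cE x0W _ q; rewrite (negPf qW) => H; apply: notF; apply: H.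
  move=> x y xW xy; have := clW _ _ xW xy; case: eqVneq xy => [->|] //=.
  by rewrite adj_sym => qx; have := nqW x; rewrite xW qx.
pose r x y := [&& adj E x y, x \in W & y \in W].
have r_sym : connect_sym r.
  by apply: sym_connect_sym => x y; rewrite /r adj_sym [(x \in W) && _]andbC.
pose C := [set x in W | connect r w x]%SET.
have CW : C \subset W by apply/fintype.subsetP => x; rewrite inE => /andP[].
have wC : w \in C by rewrite inE wW connect0.
have C_step x y : x \in C -> y \in W -> adj E x y -> y \in C.
  rewrite !inE => /andP[xW wx] yW xy; rewrite yW (connect_trans wx) //.
  by apply: connect1; rewrite /r xy xW.
(* [C] is the branch of [W] rooted at [w]. If it has fewer than 5 vertices, it is cut off, which
   leaves at least 9 - 4; if it is a larger proper part of [W], it replaces [W]; if it is all of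
   [W], its root [w] takes the place of [q]. *)
have [C5|C5] := leqP 5 #|C|; last first.
  have cardD : #|(W :\: C)%SET| = #|W| - #|C| by rewrite cardsD (setIidPr CW).
  have : 0 < #|C| by apply/card_gt0P; exists w.
  move=> C0; apply: (IHk q (W :\: C)%SET); rewrite ?cardD; try lia.
  split=> [|x y]; first by rewrite inE negb_and qW orbT.
  rewrite !inE => /andP[xC xW] xy; have /orP[->|yW] := clW _ _ xW xy; first by [].
  rewrite yW andbT orbC; apply/orP; left; apply: contra xC => yC.
  by have := C_step y x; rewrite !inE yW xW adj_sym; apply.
have [CeqW|CneqW] := eqVneq C W; last first.
  have : #|C| < #|W| by rewrite proper_card // properEneq CneqW.
  move=> ltCW; apply: (IHk q C) => //; first by lia.
  split=> [|x y xC xy]; first by apply: contra qW; apply: (fintype.subsetP CW).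
  have /orP[->//|yW] := clW _ _ (fintype.subsetP CW _ xC) xy.
  by rewrite (C_step x y) ?orbT.
have := cardsD1 w W; rewrite wW => cardD1.
apply: (IHk w (W :\ w)%SET); try lia.
split=> [|x y]; first by rewrite !inE eqxx.
rewrite !inE => /andP[xw xW] xy; have /orP[/eqP yq|->] := clW _ _ xW xy; last first.
  by rewrite andbT orbN.
(* A neighbour [x] of [q] in [W] other than [w] would close a cycle: from [q] to [w], inside [W] to
   [x], and back to [q]. *)
exfalso; have : x \in C by rewrite CeqW.
rewrite inE => /andP[_ /connectP[p0 p0P xE]].
case: (shortenP p0P) xE => p pP p_uniq _ xE.
have pW : all (mem W) p.
  elim: (p) (w) pP => //= z p' IHp u /andP[/and3P[_ _ zW]] /IHp->.
  by rewrite zW.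
have padj : path (adj E) w p by apply: sub_path pP => u v /and3P[].
apply: (aE [:: q, w & p]) => /=.
  by case: (p) xE xw => //= ->; rewrite eqxx.
apply/andP; split.
  by rewrite /= qw rcons_path padj -xE -yq.
rewrite cons_uniq p_uniq andbT inE negb_or; apply/andP; split.
  by apply: contra qW => /eqP->.
by apply: contra qW => /(allP pW).
Qed.

(** * Surgery *)

(* The first five vertices c, a1, b1, a2, b2 of [w] become the paths q - c - a1 -
   b1 and c - a2 - b2, and all further vertices leaves at c. *)
Definition regraft_parent (T : eqType) (q : T) (w : seq T) (x : T) : T :=
  if x == nth q w 0 then q
  else if x == nth q w 2 then nth q w 1
  else if x == nth q w 4 then nth q w 3
  else nth q w 0.

Definition regraft (T : finType) (E : {set {set T}}) (q : T) (w : seq T) :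
    {set {set T}} :=
  graph_of_rel (fun x y => [&& x \notin w, y \notin w & adj E x y]
                           || (x \in w) && (y == regraft_parent q w x)).

Lemma adj_regraft_out (T : finType) (E : {set {set T}}) q w x y :
  x \notin w -> y \notin w -> adj (regraft E q w) x y = adj E x y.
Proof.
move=> xw yw; rewrite adj_graph_of_rel xw yw (negPf xw) (negPf yw) /= ?orbF.
by rewrite (adj_sym E y) orbb.
Qed.

Lemma adj_regraft_in (T : finType) (E : {set {set T}}) q w x y :
  x \in w -> adj (regraft E q w) x y =
    (y == regraft_parent q w x) || (y \in w) && (x == regraft_parent q w y).
Proof.
by move=> xw; rewrite adj_graph_of_rel xw /= andbF.
Qed.

(** The complete neighbourhoods of the vertices of the new branch, from which the later arguments
    read off adjacency. *)
Variant regraft_spec (T : finType) (E : {set {set T}}) (q : T) (w : seq T) :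
    Prop :=
  RegraftSpec c a1 b1 a2 b2 l of
    w = [:: c, a1, b1, a2, b2 & l] & a1 != a2 &
    [/\ forall y, adj (regraft E q w) c y = [|| y == q, y == a1, y == a2 | y \in l],
        pendant_edge (regraft E q w) c a1 b1,
        pendant_edge (regraft E q w) c a2 b2 &
        forall x y, x \in l -> adj (regraft E q w) x y = (y == c)] &
    forall x y, x \notin w -> y \in w ->
      adj (regraft E q w) x y = (x == q) && (y == c).

Lemma regraftP (T : finType) (E : {set {set T}}) q w :
  uniq (q :: w) -> 4 < size w -> regraft_spec E q w.
Proof.
case: w => [|c [|a1 [|b1 [|a2 [|b2 l]]]]] // uniq_w _.
have := uniq_w; rewrite /= !inE !negb_or -!andbA.
move=> /and5P[qc qa1 qb1 qa2 /and5P[qb2 ql ca1 cb1 /and5P[ca2 cb2 cl a1b1 ]]].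
move=> /and5P[a1a2 a1b2 a1l b1a2 /and5P[b1b2 b1l a2b2 a2l /andP[b2l _]]].
have neqs := (negPf qc, negPf qa1, negPf qb1, negPf qa2, negPf qb2,
  negPf ca1, negPf cb1, negPf ca2, negPf cb2, negPf a1b1, negPf a1a2,
  negPf a1b2, negPf b1a2, negPf b1b2, negPf a2b2).
have neqs' := (neqs, (eq_sym c q, eq_sym a1 q, eq_sym b1 q, eq_sym a2 q,
  eq_sym b2 q, eq_sym a1 c, eq_sym b1 c, eq_sym a2 c, eq_sym b2 c,
  eq_sym b1 a1, eq_sym a2 a1, eq_sym b2 a1, eq_sym a2 b1, eq_sym b2 b1,
  eq_sym b2 a2)).
have notl := (negPf ql, negPf cl, negPf a1l, negPf b1l, negPf a2l, negPf b2l).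
set w := [:: c, a1, b1, a2, b2 & l].
have par_l x : x \in l -> regraft_parent q w x = c.
  move=> xl; rewrite /regraft_parent /=.
  by case: eqP xl => [->|_]; rewrite ?notl //; case: eqP => [->|_];
    rewrite ?notl //; case: eqP => [->|_]; rewrite ?notl.
have [pc pa1 pb1 pa2 pb2] : [/\ regraft_parent q w c = q,
    regraft_parent q w a1 = c, regraft_parent q w b1 = a1,
    regraft_parent q w a2 = c & regraft_parent q w b2 = a2].
  by rewrite /regraft_parent /= !eqxx !neqs'.
have child x y : (y \in w) && (x == regraft_parent q w y) =
    [|| (y == c) && (x == q), (y == a1) && (x == c), (y == b1) && (x == a1),
        (y == a2) && (x == c), (y == b2) && (x == a2) | (y \in l) && (x == c)].
  rewrite !inE; case: (eqVneq y c) => [->|_]; first by rewrite pc !neqs' notl ?orbF.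
  case: (eqVneq y a1) => [->|_]; first by rewrite pa1 !neqs' notl ?orbF.
  case: (eqVneq y b1) => [->|_]; first by rewrite pb1 !neqs' notl ?orbF.
  case: (eqVneq y a2) => [->|_]; first by rewrite pa2 !neqs' notl ?orbF.
  case: (eqVneq y b2) => [->|_]; first by rewrite pb2 notl ?orbF.
  by have [/par_l->|] := boolP (y \in l).
have mem_w := (mem_head, inE, eqxx, orbT).
apply: RegraftSpec; [by [] | by [] | split |].
- move=> y; rewrite adj_regraft_in ?mem_w // child pc !neqs' !eqxx !andbF.
  by rewrite !andbT /= ?orbF.
- split=> [|y|y]; first by rewrite !neqs'.
    rewrite adj_regraft_in ?mem_w // child pa1 !neqs' !eqxx !andbF.
    by rewrite !andbT /= ?orbF.
  rewrite adj_regraft_in ?mem_w // child pb1 !neqs' !andbF.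
  by rewrite /= ?orbF.
- split=> [|y|y]; first by rewrite !neqs'.
    rewrite adj_regraft_in ?mem_w // child pa2 !neqs' !eqxx !andbF.
    by rewrite !andbT /= ?orbF.
  rewrite adj_regraft_in ?mem_w // child pb2 !neqs' !andbF.
  by rewrite /= ?orbF.
- move=> x y xl; rewrite adj_regraft_in ?inE ?xl ?orbT // child par_l //.
  have xneq z : z \notin l -> (x == z) = false.
    by move=> zl; apply: contraNF zl => /eqP<-.
  by rewrite !xneq // !andbF ?orbF.
- move=> x y xw yw; rewrite adj_sym adj_regraft_in //.
  rewrite (negPf xw) /= orbF -[LHS]andTb -yw child.
  move: xw; rewrite !inE !negb_or => /and5P[xc xa1 _ xa2 /andP[_ xl]].
  by rewrite (negPf xc) (negPf xa1) (negPf xa2) !andbF ?orbF andbC.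
Qed.

(** Every vertex is joined to [q]: one in [w] along the new branch, one outside by an old path from
    [q] whose visits to the limb are collapsed. *)
Lemma connected_regraft (T : finType) (E : {set {set T}}) q w :
  connected_graph E -> uniq (q :: w) -> 4 < size w ->
  (forall x y, x \in w -> adj E x y -> y \in q :: w) ->
  connected_graph (regraft E q w).
Proof.
move=> [T0 cE] uniq_w size_w clw; split=> //.
have qw : q \notin w by case/andP: uniq_w.
have csym := sym_connect_sym (adj_sym (regraft E q w)).
suff to_q x : connect (adj (regraft E q w)) q x.
  by move=> x y; apply: (@connect_trans _ _ q); rewrite // csym.
have [xw|xw] := boolP (x \in w).
  have [c a1 b1 a2 b2 l wE _ [cE' [_ a1E b1E] [_ a2E b2E] lE] _] :=
    regraftP E uniq_w size_w.
  have qc : connect (adj (regraft E q w)) q c.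
    by rewrite csym connect1 // cE' eqxx.
  have qa1 : connect (adj (regraft E q w)) q a1.
    by apply: connect_trans qc (connect1 _); rewrite cE' eqxx !orbT.
  have qa2 : connect (adj (regraft E q w)) q a2.
    by apply: connect_trans qc (connect1 _); rewrite cE' eqxx !orbT.
  move: xw; rewrite {1}wE !inE => /or4P[/eqP->|/eqP->|/eqP->|/or3P[/eqP->|/eqP->|xl]] //.
  - by apply: connect_trans qa1 (connect1 _); rewrite a1E eqxx !orbT.
  - by apply: connect_trans qa2 (connect1 _); rewrite a2E eqxx !orbT.
  - by apply: connect_trans qc (connect1 _); rewrite cE' xl !orbT.
(* Collapse the limb to [q]. *)
pose h y := if y \in w then q else y.
have h_edge y z : adj E y z -> connect (adj (regraft E q w)) (h y) (h z).
  move=> yz; rewrite /h; case: ifP => yw; case: ifP => zw //.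
  - by have := clw _ _ yw yz; rewrite inE zw orbF => /eqP->.
  - by have := clw z y zw; rewrite adj_sym inE yw orbF => /(_ yz)/eqP->.
  - by rewrite connect1 // adj_regraft_out ?yw ?zw.
suff: connect (adj (regraft E q w)) (h q) (h x).
  by rewrite /h (negPf qw) (negPf xw).
have /connectP[p pP ->] := cE q x.
suff h_path y : path (adj E) y p ->
    connect (adj (regraft E q w)) (h y) (h (last y p)) by apply: h_path.
elim: p y {pP} => [|z p IHp] y //= /andP[yz pP].
exact: connect_trans (h_edge _ _ yz) (IHp z pP).
Qed.

(** A vertex with at most one neighbour on a cycle is not on it. This removes first the leaves [b1],
    [b2] and [l], then [a1] and [a2], then [c], so the cycle avoids [w] and already lies in [E]. *)
Lemma acyclic_regraft (T : finType) (E : {set {set T}}) q w :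
  acyclic_graph E -> uniq (q :: w) -> 4 < size w ->
  acyclic_graph (regraft E q w).
Proof.
move=> aE uniq_w size_w p size_p ucyc_p.
have [c a1 b1 a2 b2 l wE _ [cE' [_ a1E b1E] [_ a2E b2E] lE] _] :=
  regraftP E uniq_w size_w.
have prune x z : (forall y, y \in p -> adj (regraft E q w) x y -> y = z) ->
    x \notin p.
  move=> xz; apply/negP => xp.
  have [y [y' [yp yp' yy' xy xy']]] :=
    ucycle_two_neighbours (adj_sym _) ucyc_p size_p xp.
  by rewrite (xz _ yp xy) (xz _ yp' xy') eqxx in yy'.
have b1p : b1 \notin p by apply: (prune _ a1) => y _; rewrite b1E => /eqP.
have b2p : b2 \notin p by apply: (prune _ a2) => y _; rewrite b2E => /eqP.
have lp x : x \in l -> x \notin p.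
  by move=> xl; apply: (prune _ c) => y _; rewrite lE // => /eqP.
have a1p : a1 \notin p.
  apply: (prune _ c) => y yp; rewrite a1E => /orP[/eqP//|/eqP yb].
  by rewrite yb (negPf b1p) in yp.
have a2p : a2 \notin p.
  apply: (prune _ c) => y yp; rewrite a2E => /orP[/eqP//|/eqP yb].
  by rewrite yb (negPf b2p) in yp.
have cp : c \notin p.
  apply: (prune _ q) => y yp; rewrite cE' => /or4P[/eqP//|/eqP yb|/eqP yb|/lp].
  - by rewrite yb (negPf a1p) in yp.
  - by rewrite yb (negPf a2p) in yp.
  - by rewrite yp.
apply: (aE p size_p); case/andP: ucyc_p => cyc_p uniq_p; apply/andP; split=> //.
apply: (@sub_in_cycle _ [pred x | x \notin w] _ _ _ _ _ cyc_p).
  by move=> x y xw yw; rewrite adj_regraft_out.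
apply/allP => x xp; apply/negP; rewrite wE !inE.
move=> /or4P[/eqP xE|/eqP xE|/eqP xE|/or3P[/eqP xE|/eqP xE|/lp]]; last by rewrite xp.
all: by move: xp; apply/negP; rewrite xE.
Qed.

Lemma regraft_parent_neq (T : eqType) (q : T) (w : seq T) x :
  uniq (q :: w) -> 4 < size w -> x \in w -> regraft_parent q w x != x.
Proof.
move=> /andP[qw uniq_w] size_w xw; rewrite /regraft_parent.
case: ifP => [_|]; first by apply: contraNneq qw => ->.
case: ifP => [/eqP-> _|_]; first by rewrite nth_uniq //; lia.
case: ifP => [/eqP-> _|_]; first by rewrite nth_uniq //; lia.
by rewrite eq_sym => ->.
Qed.

Lemma is_tree_regraft (T : finType) (E : {set {set T}}) q w :
  is_tree E -> uniq (q :: w) -> 4 < size w ->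
  (forall x y, x \in w -> adj E x y -> y \in q :: w) ->
  is_tree (regraft E q w).
Proof.
move=> [sE cE aE] uniq_w size_w clw; split.
- apply: simple_graph_of_rel => x.
  apply/negbTE; rewrite negb_or; apply/andP; split.
    by apply/negP => /and3P[_ _ /(simple_adj_neq sE)]; rewrite eqxx.
  by apply/andP => -[xw]; rewrite eq_sym (negPf (regraft_parent_neq uniq_w size_w xw)).
- exact: connected_regraft.
- exact: acyclic_regraft.
Qed.

Lemma spider_regraft (T : finType) (E : {set {set T}}) q w :
  uniq (q :: w) -> 4 < size w -> spider (regraft E q w) (nth q w 0).
Proof.
move=> uniq_w size_w.
have [c a1 b1 a2 b2 l wE a12 [_ p1 p2 _] _] := regraftP E uniq_w size_w.
by exists a1, b1, a2, b2; rewrite {2 4}wE.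
Qed.

(** * Recovering the site of the surgery *)

(** Within the limb only [c] has two pendant paths: leaves have one neighbour, and [a1], [a2] have
    only [c] and a leaf as neighbours. A spider off the limb would already be one of [E]. *)
Lemma spider_regraft_unique (T : finType) (E : {set {set T}}) q w v :
  uniq (q :: w) -> 4 < size w ->
  (forall x y, x \in w -> adj E x y -> y \in q :: w) ->
  (forall x, ~ spider E x) -> spider (regraft E q w) v -> v = nth q w 0.
Proof.
move=> uniq_w size_w clw no_spider [a [b [a' [b' [aa' p p']]]]].
have [c a1 b1 a2 b2 l wE a12 [cE' pa1 pa2 lE] outE] := regraftP E uniq_w size_w.
have qa1 : q != a1.
  by case/andP: uniq_w => + _; apply: contraNneq => ->; rewrite wE !inE eqxx orbT.
have cw : c \in w by rewrite wE mem_head.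
have qw : q \notin w by case/andP: uniq_w.
have [vw|vw] := boolP (v \in w).
  have leaf z t : pendant_edge (regraft E q w) z t v -> False.
    move=> [_ _ vE]; have [_ aE _] := p; have [_ aE' _] := p'.
    have := vE a; rewrite adj_sym aE eqxx => /esym/eqP at_.
    have := vE a'; rewrite adj_sym aE' eqxx => /esym/eqP at_'.
    by rewrite at_ at_' eqxx in aa'.
  have mid t : pendant_edge (regraft E q w) c v t -> False.
    move=> [_ vE tE].
    (* A pendant path leaves [v] through a vertex of degree two, never through the leaf [t]. *)
    have not_t z y : pendant_edge (regraft E q w) v z y -> z != t.
      move=> [vy zE _]; apply/eqP => zt; have := tE y; rewrite -zt zE eqxx orbT.
      by move=> /esym/eqP yv; rewrite yv eqxx in vy.
    have [_ aE _] := p; have [_ aE' _] := p'.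
    have := vE a; rewrite adj_sym aE eqxx (negPf (not_t _ _ p)) orbF.
    have := vE a'; rewrite adj_sym aE' eqxx (negPf (not_t _ _ p')) orbF.
    by move=> /esym/eqP a'c /esym/eqP ac; rewrite a'c ac eqxx in aa'.
  move: (vw); rewrite {1}wE !inE.
  move=> /or4P[/eqP->|/eqP va1|/eqP vb1|/or3P[/eqP va2|/eqP vb2|vl]].
  - by rewrite wE.
  - by case: (mid b1); rewrite va1.
  - by case: (leaf c a1); rewrite vb1.
  - by case: (mid b2); rewrite va2.
  - by case: (leaf c a2); rewrite vb2.
  - have [_ aE _] := p; have [_ aE' _] := p'.
    have := lE v a vl; rewrite adj_sym aE eqxx => /esym/eqP ac.
    have := lE v a' vl; rewrite adj_sym aE' eqxx => /esym/eqP ac'.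
    by rewrite ac ac' eqxx in aa'.
(* Off the limb, pendant edges of the new graph stay away from [q]. *)
have pull z t : pendant_edge (regraft E q w) v z t -> pendant_edge E v z t.
  move=> [vt zE tE].
  (* Otherwise [v = q] and [z = c], but [c] has the neighbours [a1] and [a2] besides [q], so its
     degree is not two. *)
  have zw : z \notin w.
    apply/negP => zw; have := outE v z vw zw; rewrite adj_sym zE eqxx.
    move=> /esym/andP[_ /eqP zc].
    have := cE' a1; rewrite -zc zE eqxx orbT; have := cE' a2.
    have a1w : a1 \in w by rewrite wE !inE eqxx !orbT.
    have a2w : a2 \in w by rewrite wE !inE eqxx !orbT.
    have neqv y : y \in w -> (y == v) = false.
      by move=> yw; apply: contraNF vw => /eqP<-.
    rewrite -zc zE eqxx !orbT !neqv //= => /eqP a2t /eqP a1t.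
    by rewrite a1t a2t eqxx in a12.
  have tw : t \notin w.
    apply/negP => tw; have := outE z t zw tw; rewrite adj_sym tE eqxx.
    move=> /esym/andP[/eqP zq /eqP tc].
    have := tE a1; rewrite tc cE' eqxx orbT zq => /esym/eqP a1q.
    by rewrite a1q eqxx in qa1.
  have neqc y : y \notin w -> (c == y) = false.
    by move=> yw; apply: contraNF yw => /eqP<-.
  (* [q] has the neighbour [c] in [w], whereas all neighbours of [z] and of [t] lie outside [w]. *)
  have zq : z != q.
    apply/eqP => zq; have := zE c.
    by rewrite adj_sym zq cE' eqxx !neqc.
  have tq : t != q.
    apply/eqP => tq; have := tE c.
    by rewrite adj_sym tq cE' eqxx !neqc.
  have far x y : x \notin w -> x != q -> y \in w -> adj E x y = false.
    move=> xw xq yw; apply/negP; rewrite adj_sym => /(clw _ _ yw).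
    by rewrite inE (negPf xw) (negPf xq).
  split=> // y; have [yw|yw] := boolP (y \in w).
  - rewrite far //; apply/esym/negbTE; rewrite negb_or.
    by apply/andP; split; apply: contraTneq yw => ->.
  - by rewrite -zE adj_regraft_out.
  - by rewrite far //; apply/esym/negbTE; apply: contraTneq yw => ->.
  - by rewrite -tE adj_regraft_out.
by case: (no_spider v); exists a, b, a', b'; split=> //; apply: pull.
Qed.

(** The limb is listed as a sequence because its order assigns the roles in the surgery and indexes
    the adjacency matrix kept of the old tree. *)
Definition graft_site (T : finType) (E : {set {set T}}) (q : T) (w : seq T) :
    Prop :=
  [/\ uniq (q :: w), 4 < size w <= 8 &
      forall x y, x \in w -> adj E x y -> y \in q :: w].

(** [g] matches the spiders [c] and [c']. With more than 10 vertices in all, [q2] has too much of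
    the tree behind it to be the image of [a1], [a2] or a leaf, so [g q1 = q2]. The rest of the limb
    is reached from [c] without passing [q1], so it lands in [w2]. *)
Lemma regraft_iso_limb (T : finType) (E1 E2 : {set {set T}}) q1 w1 q2 w2
    (g : {perm T}) :
  graft_site E1 q1 w1 -> graft_site E2 q2 w2 -> connected_graph E2 ->
  (forall x, ~ spider E2 x) -> 10 < #|T| ->
  (forall x y, adj (regraft E2 q2 w2) (g x) (g y) = adj (regraft E1 q1 w1) x y) ->
  g q1 = q2 /\ forall x, x \in w1 -> g x \in w2.
Proof.
move=> [u1 /andP[s1 _] cl1] [u2 /andP[s2 s2'] cl2] cE2 no_spider card_T gE.
have g_c := spider_regraft_unique u2 s2 cl2 no_spider
  (spider_iso gE (spider_regraft E1 u1 s1)).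
have [c a1 b1 a2 b2 l w1E _ [cE [_ a1E b1E] [_ a2E b2E] lE] _] :=
  regraftP E1 u1 s1.
have [c' a1' b1' a2' b2' l' w2E _ [cE' _ _ _] outE] := regraftP E2 u2 s2.
have {}g_c : g c = c' by move: g_c; rewrite w1E w2E.
have c'w2 : c' \in w2 by rewrite w2E mem_head.
have cE2' := connected_regraft cE2 u2 s2 cl2.
have adj_w2 y z : y \in w2 -> adj (regraft E2 q2 w2) y z ->
    z \in w2 \/ z = q2 /\ y = c'.
  move=> yw yz; have [zw|zw] := boolP (z \in w2); first by left.
  by right; move: yz; rewrite adj_sym outE // => /andP[/eqP-> /eqP->].
(* Otherwise the component of [q2] off the limb would have at most two
   vertices. *)
have big t : (forall y, adj (regraft E2 q2 w2) q2 y -> y \in [:: q2, t & w2]) ->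
    (forall y, adj (regraft E2 q2 w2) t y -> y \in [:: q2, t & w2]) -> False.
  move=> q2t tq2; pose A := [set x in [:: q2, t & w2]]%SET.
  have inA x : x \in A.
    apply: (connected_closed_set cE2' (x0 := q2)); first by rewrite !inE eqxx.
    move=> y z; rewrite !(inE, in_set) => /or3P[/eqP->|/eqP->|yw] yz.
    - by have := q2t _ yz; rewrite !inE.
    - by have := tq2 _ yz; rewrite !inE.
    - by have [->|[->]] := adj_w2 _ _ yw yz; rewrite ?eqxx ?orbT.
  (* [q2], [t] and at most 8 vertices of [w2]: hence the bound 10. *)
  have : #|T| <= size [:: q2, t & w2].
    rewrite -cardsT; apply: leq_trans (card_size _).
    by apply: subset_leq_card; apply/fintype.subsetP => x _; have := inA x; rewrite inE.
  by move: card_T s2' => /=; lia.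
have gVE x y : adj (regraft E2 q2 w2) (g x) y = adj (regraft E1 q1 w1) x (g^-1%g y).
  by rewrite -gE permKV.
have q2E y : adj (regraft E2 q2 w2) q2 y =
    adj (regraft E1 q1 w1) (g^-1%g q2) (g^-1%g y) by rewrite -gVE permKV.
have gq : g q1 = q2.
  (* The preimage of [q2] is a neighbour of [c]. If it were [a1] or [a2], the image of the leaf
     beyond it would serve as [t] in [big]; if it were in [l], then [q2] would be a leaf at [c'],
     and [t = c'] serves. *)
  have := cE (g^-1%g q2); rewrite -gVE g_c cE' eqxx => /esym.
  have pend a b : (forall y, adj (regraft E1 q1 w1) a y = (y == c) || (y == b)) ->
      (forall y, adj (regraft E1 q1 w1) b y = (y == a)) ->
      g^-1%g q2 == a -> False.
    move=> aE bE /eqP q2a; apply: (big (g b)) => y.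
      rewrite q2E q2a aE => /orP[/eqP yc|/eqP yb].
        by rewrite -[y](permKV g) yc g_c !inE c'w2 !orbT.
      by rewrite -[y](permKV g) yb !inE eqxx !orbT.
    by rewrite gVE bE -q2a (inj_eq perm_inj) => /eqP->; rewrite inE eqxx.
  case/or4P=> [/eqP<-|/(pend _ _ a1E b1E)|/(pend _ _ a2E b2E)|q2l] //.
    by rewrite permKV.
  exfalso; apply: (big c') => y.
    rewrite q2E lE // => /eqP yc.
    by rewrite -[y](permKV g) yc g_c !inE eqxx !orbT.
  by move=> /(adj_w2 _ _ c'w2)[yw|[-> _]]; rewrite !inE ?eqxx ?yw ?orbT.
split=> // x xw.
have near y z : g y \in w2 -> adj (regraft E1 q1 w1) y z -> g z != q2 -> g z \in w2.
  move=> yw; rewrite -gE => /(adj_w2 _ _ yw)[|[-> _]] //.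
  by rewrite eqxx.
have notq z : z \in w1 -> g z != q2.
  move=> zw; rewrite -gq (inj_eq perm_inj).
  by case/andP: u1 => + _; apply: contraNneq => <-.
have xq := notq _ xw.
have cw : g c \in w2 by rewrite g_c.
have aw a : a \in w1 -> adj (regraft E1 q1 w1) c a -> g a \in w2.
  by move=> aw1 ca; apply: near ca (notq _ aw1).
have [a1w a2w] : g a1 \in w2 /\ g a2 \in w2.
  by split; apply: aw; rewrite ?cE ?w1E ?inE ?eqxx ?orbT.
move: (xw); rewrite {1}w1E !inE.
move=> /or4P[/eqP->|/eqP->|/eqP xE|/or3P[/eqP->|/eqP xE|xl]] //.
- by apply: near a1w _ xq; rewrite a1E xE eqxx orbT.
- by apply: near a2w _ xq; rewrite a2E xE eqxx orbT.
- by apply: aw => //; rewrite cE xl !orbT.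
Qed.

Lemma graph_isoP (T : finType) (E E' : {set {set T}}) :
  reflect (exists g : {perm T}, forall x y, adj E' (g x) (g y) = adj E x y)
          (graph_iso E E').
Proof.
apply: (iffP existsP) => -[g gP]; exists g.
  by move=> x y; have /forallP/(_ x)/forallP/(_ y)/eqP := gP.
by apply/forallP => x; apply/forallP => y; apply/eqP.
Qed.

(** The new isomorphism matches [w1] with [w2] in their listed order, which respects the old edges
    there, and follows [g] elsewhere, where the surgery changed nothing; [g q1 = q2] makes the two
    fit together. *)
Lemma regraft_cancel (T : finType) (E1 E2 : {set {set T}}) q1 w1 q2 w2 :
  graft_site E1 q1 w1 -> graft_site E2 q2 w2 ->
  connected_graph E1 -> connected_graph E2 ->
  (forall x, ~ spider E1 x) -> (forall x, ~ spider E2 x) -> 10 < #|T| ->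
  size w1 = size w2 ->
  (forall i j, i <= size w1 -> j <= size w1 ->
     adj E1 (nth q1 (q1 :: w1) i) (nth q1 (q1 :: w1) j) =
     adj E2 (nth q2 (q2 :: w2) i) (nth q2 (q2 :: w2) j)) ->
  graph_iso (regraft E1 q1 w1) (regraft E2 q2 w2) -> graph_iso E1 E2.
Proof.
move=> g1 g2 cE1 cE2 ns1 ns2 card_T size12 trace /graph_isoP[g gE].
have [gq gw] := regraft_iso_limb g1 g2 cE2 ns2 card_T gE.
have gVE x y : adj (regraft E1 q1 w1) (g^-1%g x) (g^-1%g y) =
    adj (regraft E2 q2 w2) x y by rewrite -gE !permKV.
(* The inverse of [g] shows that vertices off [w1] stay off [w2]. *)
have [_ gVw] := regraft_iso_limb g2 g1 cE1 ns1 card_T gVE.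
have [u1 _ cl1] := g1; have [u2 _ cl2] := g2.
have [q1w uw1] := andP u1; have [q2w uw2] := andP u2.
pose f x := if x \in w1 then nth q2 w2 (index x w1) else g x.
have f_in x : x \in w1 -> f x \in w2.
  by move=> xw; rewrite /f xw mem_nth // -size12 index_mem.
have f_out x : x \notin w1 -> f x \notin w2.
  move=> xw; rewrite /f (negPf xw); apply: contra xw => /gVw.
  by rewrite permK.
have f_inj : injective f.
  move=> x y; have [xw|xw] := boolP (x \in w1); have [yw|yw] := boolP (y \in w1).
  - rewrite /f xw yw => /eqP; rewrite nth_uniq -?size12 ?index_mem // => /eqP.
    by apply: index_inj.
  - by move=> fxy; have := f_in _ xw; rewrite fxy (negPf (f_out _ yw)).
  - by move=> fxy; have := f_in _ yw; rewrite -fxy (negPf (f_out _ xw)).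
  - by rewrite /f (negPf xw) (negPf yw) => /perm_inj.
have fE x : x \in q1 :: w1 -> f x = nth q2 (q2 :: w2) (index x (q1 :: w1)).
  rewrite inE /=; case: eqVneq => [->|_] /=; first by rewrite /f (negPf q1w).
  by move=> xw; rewrite /f xw.
have fP x y : x \in w1 -> adj E2 (f x) (f y) = adj E1 x y.
  move=> xw; have xw' : x \in q1 :: w1 by rewrite inE xw orbT.
  have [yw|yw] := boolP (y \in q1 :: w1).
    have idx z : z \in q1 :: w1 -> index z (q1 :: w1) <= size w1.
      by rewrite -index_mem.
    by rewrite !fE // -trace ?idx // !nth_index.
  transitivity false; last by apply/esym/negP => /(cl1 _ _ xw); rewrite (negPf yw).
  move: yw; rewrite inE negb_or => /andP[yq yw].
  apply/negP => /(cl2 _ _ (f_in _ xw)); rewrite inE (negPf (f_out _ yw)) orbF.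
  by rewrite /f (negPf yw) -gq (inj_eq perm_inj) (negPf yq).
apply/graph_isoP; exists (perm f_inj) => x y; rewrite !permE.
have [xw|xw] := boolP (x \in w1); first exact: fP.
have [yw|yw] := boolP (y \in w1); first by rewrite adj_sym fP // adj_sym.
rewrite -(adj_regraft_out E2 q2 (f_out _ xw) (f_out _ yw)).
by rewrite /f (negPf xw) (negPf yw) gE adj_regraft_out.
Qed.

(** * Counting isomorphism classes *)

(** A class of [D1] is encoded by a class of [D2] and a key in [K]; the last hypothesis makes the
    code injective. A relation [F] suffices because any representative and any admissible pair may
    be picked. *)
Lemma card_equivalence_partition_code (T K : finType) (r : rel T)
    (D1 D2 : {set T}) (F : T -> T -> K -> Prop) :
  equivalence_rel r ->
  (forall x, x \in D1 -> exists y k, y \in D2 /\ F x y k) ->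
  (forall x1 x2 y1 y2 k, F x1 y1 k -> F x2 y2 k -> r y1 y2 -> r x1 x2) ->
  #|equivalence_partition r D1| <= #|equivalence_partition r D2| * #|K|.
Proof.
move=> r_eq F_total F_inj.
pose cls (D : {set T}) x := [set z in D | r x z]%SET.
pose G X (Yk : {set T} * K) := exists x y,
  [/\ X = cls D1 x, y \in D2, Yk.1 = cls D2 y & F x y Yk.2].
pose f X := [pick Yk | `[< G X Yk >]].
have fP X : X \in equivalence_partition r D1 -> exists2 Yk, f X = Some Yk & G X Yk.
  move=> /imsetP[x xD XE]; rewrite /f.
  case: pickP => [Yk /asboolP GXY|noY]; first by exists Yk.
  have [y [k [yD Fxy]]] := F_total x xD; have := noY (cls D2 y, k).
  by move/asboolP=> []; exists x, y.
rewrite -(card_in_imset (f := f)); last first.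
  move=> X1 X2 /fP[Yk1 f1 [x1 [y1 [X1E y1D Y1 F1]]]].
  move=> /fP[Yk2 f2 [x2 [y2 [X2E y2D Y2 F2]]]]; rewrite f1 f2 X1E X2E => -[Yk12].
  have y12 : r y1 y2.
    have [r_refl _] := r_eq y2 y2 y2.
    have : y2 \in cls D2 y2 by rewrite inE y2D.
    by rewrite -Y2 -Yk12 Y1 inE => /andP[].
  have x12 : r x1 x2 by apply: F_inj F1 _ y12; rewrite Yk12.
  apply/setP => z; rewrite !inE; congr (_ && _).
  by have [_ ->] := r_eq x1 x2 z.
have -> : #|equivalence_partition r D2| * #|K| =
    #|Some @: setX (equivalence_partition r D2) [set: K]%SET|.
  by rewrite card_imset ?cardsX ?cardsT //; apply: Some_inj.
apply: subset_leq_card; apply/fintype.subsetP => _ /imsetP[X /fP[Yk -> GXY] ->].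
apply: imset_f; rewrite !inE andbT; have [x [y [_ yD -> _]]] := GXY.
by apply/imsetP; exists y.
Qed.

(* [None] stands for a tree left unchanged, [Some (m, t)] for a surgery on [m]
   vertices [w], where [t] is the adjacency matrix of the old tree on [q :: w]. *)
Definition trace_code := option ('I_9 * {ffun 'I_9 * 'I_9 -> bool}).

(** Trees are split by the property itself, not by spiders: a tree lacking the property has no
    spider, so the surgery on it can be undone. *)
Lemma tau_le_sigma (R : realType) n :
  10 < n -> tau n <= sigma R n * #|{: trace_code}|.
Proof.
move=> n10.
pose F (E E' : {set {set 'I_n}}) (k : trace_code) :=
  if k is Some (m, t) then
    [/\ is_tree E, ~ neighbour_sum_property R E & exists q w,
      [/\ graft_site E q w, E' = regraft E q w, size w = m &
          forall i j : 'I_9, t (i, j) = adj E (nth q (q :: w) i) (nth q (q :: w) j)]]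
  else E' = E.
apply: (card_equivalence_partition_code (F := F) (@graph_iso_equiv 'I_n)).
  move=> E; rewrite inE => /asboolP tE.
  have [nspE|nspE] := pselect (neighbour_sum_property R E).
    by exists E, None; rewrite inE; split=> //; apply/asboolP.
  have cardT : 5 < #|'I_n| by rewrite card_ord; lia.
  have [q [W [[qW clW] sizeW]]] := bounded_limb tE cardT.
  pose w := enum W.
  have memw x : (x \in w) = (x \in W) by rewrite mem_enum.
  have site : graft_site E q w.
    split; first by rewrite /= memw qW enum_uniq.
      by rewrite -cardE.
    by move=> x y; rewrite inE !memw; apply: clW.
  have [u /andP[s s'] cl] := site; have s9 : size w < 9 by [].
  (* The matrix has room for [q] and up to 8 further vertices; indices past the end of [q :: w] read
     the default [q] and do not enter the decoding. *)
  exists (regraft E q w), (Some (Ordinal s9, [ffun ij : 'I_9 * 'I_9 =>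
    adj E (nth q (q :: w) ij.1) (nth q (q :: w) ij.2)])).
  split.
    rewrite inE; apply/asboolP; split; first exact: is_tree_regraft.
    exact: spider_neighbour_sum (spider_regraft E u s).
  split=> //; exists q, w; split=> // i j.
  by rewrite ffunE.
move=> E1 E2 E1' E2' [[m t]|] /=; last by move=> -> ->.
move=> [[_ cE1 _] n1 [q1 [w1 [g1 -> s1 t1]]]] [[_ cE2 _] n2 [q2 [w2 [g2 -> s2 t2]]]].
apply: regraft_cancel => //.
- by move=> x /(@spider_neighbour_sum R).
- by move=> x /(@spider_neighbour_sum R).
- by rewrite card_ord.
- by rewrite s1 s2.
- rewrite s1 => i j im jm; have [i9 j9] : i < 9 /\ j < 9.
    by split; apply: leq_ltn_trans (ltn_ord m).
  by rewrite -(t1 (Ordinal i9) (Ordinal j9)) -(t2 (Ordinal i9) (Ordinal j9)).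
Qed.

(** * Positivity of [tau] and the lower limit *)

Lemma is_tree_star (T : finType) (x0 : T) :
  is_tree (graph_of_rel (fun x y => (x == x0) && (y != x0))).
Proof.
split.
- by apply: simple_graph_of_rel => x; rewrite andbN.
- split; first by apply/card_gt0P; exists x0.
  set E := graph_of_rel _; have csym := sym_connect_sym (adj_sym E).
  suff to_x0 x : connect (adj E) x0 x.
    by move=> x y; apply: (@connect_trans _ _ x0); rewrite // csym.
  have [->|xx0] := eqVneq x x0; first exact: connect0.
  by rewrite connect1 // adj_graph_of_rel eqxx xx0.
- move=> c size_c ucyc_c.
  have only_x0 x : x \in c -> x = x0.
    move=> xc; apply/eqP; apply/negPn/negP => xx0.
    have [y [z [_ _ + +]]] := ucycle_two_neighbours (adj_sym _) ucyc_c size_c xc.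
    rewrite !adj_graph_of_rel (negPf xx0) /= !andbT => yz /eqP yE /eqP zE.
    by rewrite yE zE eqxx in yz.
  case/andP: ucyc_c => _; move: size_c only_x0; case: c => [|x [|y c]] // _ all_x0.
  by rewrite /= (all_x0 x) ?mem_head // (all_x0 y) ?inE ?eqxx ?orbT.
Qed.

(** Rules out quotients that are 0 by the convention on division by 0. *)
Lemma tau_gt0 n : 0 < tau n.+1.
Proof.
apply/card_gt0P; eexists; apply/imsetP.
exists (graph_of_rel (fun x y : 'I_n.+1 => (x == ord0) && (y != ord0))) => //.
by rewrite inE; apply/asboolP; apply: is_tree_star.
Qed.

Theorem theorem4p1 (R : realType) :
  (0 < limn_einf (fun n : nat => ((sigma R n)%:R / (tau n)%:R : R)%R%:E))%E.
Proof.
set u := fun n => _; pose M : R := (#|{: trace_code}|%:R)%R.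
have M0 : (0 < M)%R by rewrite ltr0n; apply/card_gt0P; exists None.
(* Index 11 is the first to which [tau_le_sigma] applies. One tail infimum is enough, as the lower
   limit is the supremum of all of them. *)
have u_ge : (M^-1%:E <= einfs u 11%N)%E.
  apply: le_ereal_inf_tmp => _ [n /= n11 <-]; rewrite /u lee_fin.
  case: n n11 => // n n11.
  rewrite ler_pdivlMr ?ltr0n ?tau_gt0 // mulrC ler_pdivrMr //.
  by rewrite -natrM ler_nat tau_le_sigma.
rewrite limn_einf_lim (cvg_lim _ (cvg_einfs_sup (u := u))) //.
apply: lt_le_trans (ereal_sup_ubound _); last by exists 11%N.
by apply: lt_le_trans u_ge; rewrite lte_fin invr_gt0.
Qed.
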